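(* Let $p \geq 3$ and $q \geq 3$ be prime numbers, let $r$ be a positive integer, and put $m = q^r$. Suppose that $\mathbb{Q}(\sqrt{1-2m^p}) \neq \mathbb{Q}(i)$. Then the class number of the imaginary quadratic field $\mathbb{Q}(\sqrt{1-2m^p})$ is divisible by $p$. *)

(* Defs.v *)
From HB Require Import structures.
From mathcomp Require Import all_boot all_order all_algebra all_field.
From mathcomp Require Import finmap.
From mathcomp Require Import boolp classical_sets functions cardinality.

Set Implicit Arguments.
Unset Strict Implicit.
Unset Printing Implicit Defensive.

Import Order.TTheory GRing.Theory Num.Theory.
Local Open Scope classical_set_scope.
Local Open Scope ring_scope.

(** Number fields are taken as subfields of [algC], the field of algebraic
    complex numbers, so that equality of number fields is equality of sets. *)

Definition is_subfield (F : set algC) : Prop := divring_closed (mem F).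

Definition Qadj (z : algC) : set algC := smallest is_subfield [set z].

Definition ring_of_integers (K : set algC) : set algC :=
  K `&` [set x | x \in Aint].

Definition is_ideal (K I : set algC) : Prop :=
  [/\ I `<=` ring_of_integers K,
      I 0,
      (forall x y, I x -> I y -> I (x + y))
    & (forall a x, ring_of_integers K a -> I x -> I (a * x))].

Definition nonzero_ideals (K : set algC) : set (set algC) :=
  [set I | is_ideal K I /\ I <> [set 0]].

Definition ideal_equiv (K I J : set algC) : Prop :=
  exists a b : algC,
    [/\ ring_of_integers K a, ring_of_integers K b, a != 0, b != 0
      & [set a * x | x in I] = [set b * y | y in J]].

Definition ideal_class (K I : set algC) : set (set algC) :=
  [set J | nonzero_ideals K J /\ ideal_equiv K I J].

Definition ideal_classes (K : set algC) : set (set (set algC)) :=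
  [set ideal_class K I | I in nonzero_ideals K].

(** [fset_set] is empty on infinite sets, so [class_number] is meaningful only
    together with [finite_set (ideal_classes K)]. *)
Definition class_number (K : set algC) : nat :=
  #|` fset_set (ideal_classes K)|%fset.

(* Main.v *)
Require Import Defs.
From mathcomp Require Import all_boot all_order all_algebra all_field.
From mathcomp Require Import boolp classical_sets cardinality.
From mathcomp Require Import finmap all_fingroup all_solvable zify ring.

(** Write [1 - 2 m^p = - t^2 e] with [e] squarefree; then [e = 1 mod 4], [e > 1],
    and the integers of [K] are the [a + b w] with [w^2 = - e]. The element
    [b = 1 - m^p + t w = (1 + t w)^2 / 2] has norm [m^(2 p)] and is coprime to
    its conjugate, so the ideal [(m^2, b)] has [p]-th power [(b)]. Multiplication
    by it therefore acts on the finite set of ideal classes with period [p], and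
    [p] divides the class number as soon as no class is fixed.

    A fixed class makes [b] a [p]-th power [gamma^p] in [K], since the only units
    of [K] are [1] and [-1]. With [p = 2 h + 1], the integer
    [delta = (1 + t w) / gamma^h] satisfies [delta^p = 2^h (1 + t w)]. Its rational
    part is odd and divides [2^h], so up to sign [delta = 1 + w'] with
    [w'^2 = 1 - 2 m], and [(1 + w') (1 - m + w')^h] has rational part [1] or [-1].
    A 2-adic expansion (and reduction modulo 3 when [m = 3]) then gives [h = 0]. *)

Set Implicit Arguments.
Unset Strict Implicit.
Unset Printing Implicit Defensive.

Import Order.TTheory GRing.Theory Num.Theory.
Local Open Scope ring_scope.

(** * Quadratic integers and the 2-adic argument *)

(** The order Z[w]. *)
Definition quad_int (w z : algC) : Prop :=
  exists a b : int, z = a%:~R + b%:~R * w.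

Section QuadInt.

Variables (w : algC) (e : nat).
Hypothesis w2 : w ^+ 2 = - e%:R.

Lemma quad_int_int (a : int) : quad_int w a%:~R.
Proof. by exists a, 0; rewrite mul0r addr0. Qed.

Lemma quad_int_nat (a : nat) : quad_int w a%:R.
Proof. exact: quad_int_int a. Qed.

Lemma quad_int_gen : quad_int w w.
Proof. by exists 0, 1; rewrite add0r mul1r. Qed.

Lemma quad_intN x : quad_int w x -> quad_int w (- x).
Proof. by move=> [a [b ->]]; exists (- a), (- b); ring. Qed.

Lemma quad_intD x y : quad_int w x -> quad_int w y -> quad_int w (x + y).
Proof. by move=> [a [b ->]] [c [d ->]]; exists (a + c), (b + d); ring. Qed.

Lemma quad_intM x y : quad_int w x -> quad_int w y -> quad_int w (x * y).
Proof.
move=> [a [b ->]] [c [d ->]]; exists (a * c - e%:Z * b * d), (a * d + b * c).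
have -> : (a%:~R + b%:~R * w) * (c%:~R + d%:~R * w) =
   a%:~R * c%:~R + (a%:~R * d%:~R + b%:~R * c%:~R) * w
   + b%:~R * d%:~R * w ^+ 2 :> algC by ring.
rewrite w2; ring.
Qed.

Lemma quad_intX x n : quad_int w x -> quad_int w (x ^+ n).
Proof.
move=> qx; elim: n => [|n IHn]; first exact: quad_int_int 1.
by rewrite exprS; apply: quad_intM.
Qed.

Hypothesis e_gt0 : (0 < e)%N.

(** A coincidence gives [(a - c) ^+ 2 + e * (d - b) ^+ 2 = 0], a sum of nonnegative integers. *)
Lemma quad_int_inj (a b c d : int) :
  a%:~R + b%:~R * w = c%:~R + d%:~R * w -> a = c /\ b = d.
Proof.
move=> eq_w.
have : ((a - c)%:~R : algC) ^+ 2 = ((d - b)%:~R * w) ^+ 2.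
  congr (_ ^+ 2); apply: (addIr (b%:~R * w + c%:~R)).
  transitivity (a%:~R + b%:~R * w : algC); first by ring.
  by rewrite eq_w; ring.
rewrite exprMn w2 => eq2.
have : (((a - c) ^+ 2 + e%:Z * (d - b) ^+ 2)%:~R : algC) = 0.
  by rewrite rmorphD rmorphXn /= eq2; ring.
move/eqP; rewrite intr_eq0 => /eqP eq0.
move/eqP: eq0; rewrite paddr_eq0 ?sqr_ge0 //; last by rewrite mulr_ge0 ?sqr_ge0.
rewrite sqrf_eq0 mulf_eq0 sqrf_eq0 !subr_eq0 -[e%:Z == 0]/(e == 0%N) eqn0Ngt e_gt0 /=.
by case/andP=> /eqP-> /eqP->.
Qed.

End QuadInt.

Ltac quad_int_closure w2 :=
  repeat first [ done | exact: (quad_int_nat _ 1) | exact: quad_int_nat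
    | exact: quad_int_int | exact: quad_int_gen | apply: quad_intN
    | apply: quad_intD | apply: (quad_intM w2) | apply: (quad_intX w2) ].

(* With [c = 1 - m] and [w ^+ 2 = 1 - 2 m], the square of [c + w] is
   [c * (c + 2 + 2 * w) - 1]: this is [-1] up to a multiple of [2 * c], and the
   powers of its opposite are controlled 2-adically. *)
Lemma one_sub_pow (w : algC) (e : nat) (c c' : int) (s j : nat) :
  w ^+ 2 = - e%:R -> c = 2 * c' ->
  exists2 z, quad_int w z &
    (1 - c%:~R * (c%:~R + 2 + 2 * w)) ^+ (2 ^ s * j) =
    1 - (2 ^ s * j)%:R * c%:~R * (c%:~R + 2 + 2 * w)
      + (2 ^ s.+1)%:R * c%:~R ^+ 2 * z.
Proof.
move=> w2 c_even; set k := c%:~R + 2 + 2 * w.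
(* [k] is twice a quadratic integer, so terms in [k ^+ 2] gain the factor 4 needed when the exponent
   is doubled. *)
pose k' := c'%:~R + 1 + w.
have kE : k = 2 * k' by rewrite /k /k' c_even; ring.
have qk' : quad_int w k' by exists (c' + 1), 1; rewrite /k'; ring.
have qk : quad_int w k by rewrite kE; apply: quad_intM w2 _ _ (quad_int_nat _ 2) qk'.
have step (N : nat) : (exists2 z, quad_int w z & (1 - c%:~R * k) ^+ N =
     1 - N%:R * c%:~R * k + (2 * N)%:R * c%:~R ^+ 2 * z) ->
   forall j, exists2 z, quad_int w z & (1 - c%:~R * k) ^+ (N * j) =
     1 - (N * j)%:R * c%:~R * k + (2 * N)%:R * c%:~R ^+ 2 * z.
  move=> [z qzz eqN]; elim=> [|i [y qy eqy]].
    by exists 0; [exact: quad_int_nat 0 | rewrite muln0; ring].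
  exists (y * (1 - N%:R * c%:~R * k + (2 * N)%:R * c%:~R ^+ 2 * z)
       + z * (1 - (N * i)%:R * c%:~R * k) + 2 * (N * i)%:R * k' ^+ 2); last first.
    by rewrite mulnS exprD eqN eqy kE; ring.
  by quad_int_closure w2.
rewrite [(2 ^ s.+1)%N]expnS; apply: step.
elim: s => [|s IHs]; first by exists 0; [exact: quad_int_nat 0 | ring].
have [z qzz eqz] := IHs.
exists (z * (1 - (2 ^ s)%:R * c%:~R * k) + (2 ^ s)%:R * c%:~R ^+ 2 * z ^+ 2
        + (2 ^ s)%:R * k' ^+ 2).
  by quad_int_closure w2.
rewrite expnS mulnC exprM eqz kE natrM; ring.
Qed.

(** Modulo 3, [1 + w] is an eigenvector of multiplication by [- 2 + w], with eigenvalue 2. This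
    settles [m = 3], where [1 - m = - 2] and [1 - 2 * m = - 5]. *)
Lemma mul_pow_mod3 (w : algC) (h : nat) : w ^+ 2 = - 5%:R ->
  exists2 z, quad_int w z & (1 + w) * (- 2 + w) ^+ h = (2 ^ h)%:R * (1 + w) + 3 * z.
Proof.
move=> w2; elim: h => [|h [z qz eqz]].
  by exists 0; [exact: quad_int_nat 0 | ring].
exists (z * (- 2 + w) - (2 ^ h)%:R * (3 + w)); first by quad_int_closure w2.
rewrite exprSr mulrA eqz expnS.
have -> : ((2 ^ h)%:R * (1 + w) + 3 * z) * (-2 + w) =
   (2 ^ h)%:R * (w ^+ 2 - w - 2) + 3 * z * (- 2 + w) by ring.
rewrite w2; ring.
Qed.

(** Up to sign, [s] is the rational part for [h = 2 * k], with [k = P * j]. It is 1 modulo 4, and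
    [s - 1] is a nonzero multiple of the odd number [2 * Z - 5 * j]. *)
Lemma even_pow_neq_pm1 (c' P j Z : int) : c' != 0 -> P != 0 -> odd `|j| ->
  let s := 1 - 5 * (P * j) * (2 * c') ^+ 2 + 2 * P * (2 * c') ^+ 2 * Z in
  s <> 1 /\ s <> - 1.
Proof.
move=> c0 P0 j_odd s.
have sE : s = 1 + 4 * (P * c' ^+ 2 * (2 * Z - 5 * j)) by rewrite /s; ring.
split=> s1; last by lia.
have /eqP : P * c' ^+ 2 * (2 * Z - 5 * j) = 0 by lia.
by rewrite mulf_eq0 mulf_eq0 sqrf_eq0 (negPf c0) (negPf P0) /= => /eqP; lia.
Qed.

(** Up to sign, [s] is the rational part for [h = 2 * k + 1]. Here [s + 1 = 2 * c' * R] with [R]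
    odd, hence nonzero; [s = 1] forces [c' = R = - 1], which makes [k] even. *)
Lemma odd_pow_neq_pm1 (c' k Z : int) : c' < 0 ->
  let s := - 1 + 2 * c' * (3 - k * (7 * (2 * c') ^+ 2 + 7 * (2 * c') - 4)
                           + 2 * (2 * c') * Z) in
  s <> - 1 /\ (s = 1 -> c' = - 1 /\ ~~ odd `|k|).
Proof.
move=> c0; set R := 3 - _ + _ => s.
have RE : R = 3 + 2 * (- k * (14 * c' ^+ 2 + 7 * c' - 2) + 2 * c' * Z).
  by rewrite /R; ring.
split=> [s1|s1].
  have /eqP : c' * R = 0 by rewrite /s in s1; lia.
  by rewrite mulf_eq0 => /orP[] /eqP; lia.
have cR : c' * R = 1 by rewrite /s in s1; lia.
have c1 : c' = - 1.
  have /eqP := congr1 absz cR; rewrite abszM muln_eq1 => /andP[/eqP ? _]; lia.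
split=> //; move: cR; rewrite c1 /R; lia.
Qed.

(** With [c = 1 - m], the square of [c + w] is [- (1 - c * kappa)]. Up to sign this leaves the
    [k]-th power of [1 - c * kappa], expanded by [one_sub_pow], times [1 + w] or [(1 + w) * (c + w)]
    according to the parity of [h]. *)
Lemma rational_part_pm1 (m h : nat) (w : algC) (s b : int) :
  odd m -> (1 < m)%N -> w ^+ 2 = - (2 * m - 1)%:R ->
  (1 + w) * (1 - m%:R + w) ^+ h = s%:~R + b%:~R * w ->
  s = 1 \/ s = - 1 -> h = 0%N.
Proof.
move=> m_odd m_gt1 w2 eq_s s_pm1.
pose c' : int := - (m./2)%:Z; have [c cD] : exists c, c = 2 * c' by eexists.
have cE : 1 - m%:R = c%:~R :> algC.
  have -> : m = (2 * m./2).+1 by lia.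
  by rewrite cD /c'; ring.
have c_lt0 : c' < 0 by rewrite /c'; lia.
have c_neq0 : c' != 0 by lia.
have w2c : w ^+ 2 = 2 * c%:~R - 1.
  by rewrite w2 -cE natrB; [ring | lia].
have inj := quad_int_inj w2 (ltac:(lia) : (0 < 2 * m - 1)%N).
pose k := h./2; pose kappa := c%:~R + 2 + 2 * w.
have sq : (c%:~R + w) ^+ 2 = - (1 - c%:~R * kappa).
  transitivity (c%:~R ^+ 2 + 2 * c%:~R * w + w ^+ 2); first by ring.
  by rewrite w2c /kappa; ring.
pose sg : int := (-1) ^+ k; pose s' := sg * s.
have sg2 : sg * sg = 1 by rewrite -expr2 sqrr_sign.
have s'_pm1 : s' = 1 \/ s' = -1.
  rewrite /s' /sg -signr_odd; case: s_pm1 => ->; case: (odd k).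
  - by right.
  - by left.
  - by left.
  - by right.
have powE : (c%:~R + w) ^+ (2 * k) = sg%:~R * (1 - c%:~R * kappa) ^+ k.
  by rewrite exprM sq exprNn /sg rmorphXn rmorphN1.
rewrite cE in eq_s.
have mul_sg : sg%:~R * (s%:~R + b%:~R * w) = s'%:~R + (sg * b)%:~R * w.
  by rewrite /s'; ring.
have sg2C : sg%:~R * sg%:~R = 1 :> algC by rewrite -intrM sg2.
have [h_odd|h_even] := boolP (odd h).
  have hE : h = (2 * k).+1 by rewrite /k; lia.
  have [_ [x [y ->]]] := one_sub_pow 0 k w2 cD.
  rewrite mul1n -/kappa => eq1.
  have eqs : s'%:~R + (sg * b)%:~R * w =
      ((1 + w) * (c%:~R + w)) * (1 - c%:~R * kappa) ^+ k.
    rewrite -mul_sg -eq_s hE exprS powE.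
    transitivity (sg%:~R * sg%:~R * ((1 + w) * (c%:~R + w)) * (1 - c%:~R * kappa) ^+ k).
      by ring.
    by rewrite sg2C mul1r.
  have [s'E _] : s' = - 1 + c * (3 - k%:Z * (7 * c ^+ 2 + 7 * c - 4)
        + 2 * c * ((3 * c - 1) * x + (c + 1) * (2 * c - 1) * y))
      /\ sg * b = (c + 1) - k%:Z * c * (c ^+ 2 + 9 * c)
        + 2 * c ^+ 2 * ((3 * c - 1) * y + (c + 1) * x).
    (* Both coordinates are compared at once; eliminating [c] through [c = (w ^+ 2 + 1) / 2] leaves
       an identity in [w]. *)
    apply: inj; rewrite eqs eq1 /kappa !(rmorphD, rmorphN, rmorphM, rmorphXn) /=.
    have -> : c%:~R = (w ^+ 2 + 1) / 2 by rewrite w2c; field.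
    by field.
  have [ne imp] :=
    odd_pow_neq_pm1 k ((3 * c - 1) * x + (c + 1) * (2 * c - 1) * y) c_lt0.
  case: s'_pm1 => s'1; last by case: ne; rewrite -cD -s'E.
  have [|c1 k_even] := imp; first by rewrite -cD -s'E.
  have cm2 : c = - 2 by rewrite cD c1.
  have m3 : m = 3%N by rewrite /c' in c1; lia.
  have s1 : s = 1.
    by rewrite -s'1 /s' /sg -signr_odd (negPf k_even) mul1r.
  (* What is left is [m = 3], [s = 1] and [h] odd. Modulo 3 the rational part is [2 ^ h], that is 2:
     a contradiction. *)
  rewrite m3 in w2.
  have [_ [x' [y' ->]]] := mul_pow_mod3 h w2.
  have -> : (- 2 + w) = c%:~R + w by rewrite cm2; ring.
  rewrite eq_s => eq3.
  have [+ _] : s = (2 ^ h)%N%:Z + 3 * x' /\ b = (2 ^ h)%N%:Z + 3 * y'.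
    by apply: inj; rewrite eq3; ring.
  have : (2 ^ h = 2 %[mod 3])%N.
    by rewrite hE expnS expnM -modnMmr -modnXm /= exp1n.
  lia.
have hE : h = (2 * k)%N by rewrite /k; lia.
have [k0|k_gt0] := posnP k; first by rewrite hE k0.
(* Splitting off the 2-part of [k] shows that the correction [5 * k * c ^+ 2] has smaller 2-adic
   valuation than the error term. *)
have [j] := pfactor_coprime (isT : prime 2) k_gt0.
rewrite coprime2n => j_odd kE.
have [_ [x [y ->]]] := one_sub_pow (logn 2 k) j w2 cD.
set P := (2 ^ logn 2 k)%N in kE *; rewrite mulnC -kE -/kappa expnS => eq1.
have eqs : s'%:~R + (sg * b)%:~R * w = (1 + w) * (1 - c%:~R * kappa) ^+ k.
  rewrite -mul_sg -eq_s hE powE.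
  transitivity (sg%:~R * sg%:~R * (1 + w) * (1 - c%:~R * kappa) ^+ k).
    by ring.
  by rewrite sg2C mul1r.
have [s'E _] : s' = 1 - 5 * k%:Z * c ^+ 2
      + 2 * P%:Z * c ^+ 2 * (x + (2 * c - 1) * y)
    /\ sg * b = 1 - k%:Z * c * (c + 4) + 2 * P%:Z * c ^+ 2 * (x + y).
  apply: inj; rewrite eqs eq1 /kappa !(rmorphD, rmorphN, rmorphM, rmorphXn) /=.
  have -> : c%:~R = (w ^+ 2 + 1) / 2 by rewrite w2c; field.
  by field.
have P_neq0 : P%:Z != 0 by rewrite -[_ == _]/(P == 0)%N expn_eq0.
have [ne1 ne2] := even_pow_neq_pm1 (j := j) (x + (2 * c - 1) * y) c_neq0 P_neq0 j_odd.
by case: s'_pm1 => s'1; [case: ne1 | case: ne2];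
  rewrite -[RHS]s'1 s'E -cD kE PoszM; ring.
Qed.
(** * Counting orbits *)

(** [f] is a permutation whose [p]-th power is 1, so it generates a [p]-group; the number of its
    fixed points, here 0, is congruent to the size of the set modulo [p]. *)
Lemma dvdn_card_fixpoint_free (T : finType) (f : T -> T) (p : nat) :
  prime p -> (forall x, iter p f x = x) -> (forall x, f x <> x) -> (p %| #|T|)%N.
Proof.
move=> p_pr fp f_neq.
have f_inj : injective f.
  by move=> x y eq_f; rewrite -[x]fp -[y]fp -(prednK (prime_gt0 p_pr)) !iterSr eq_f.
pose s := perm f_inj.
have sp : (s ^+ p = 1)%g.
  by apply/permP=> x; rewrite permX perm1 -[RHS]fp; apply: eq_iter => y; rewrite permE.
have pG : (p.-group <[s]>)%g.
  by apply: pnat_dvd (pnat_id p_pr); rewrite -orderE order_dvdn sp.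
have actG : [acts <[s]>, on [set: T] | 'P]%g.
  by apply/actsP=> a _ x; rewrite !inE.
have := pgroup_fix_mod pG actG; rewrite cardsT.
suff -> : ('Fix_([set: T] | 'P)(<[s]>) = finset.set0)%g.
  by rewrite cards0 mod0n => /eqP; rewrite -/(dvdn p _).
apply/finset.setP=> x; rewrite finset.in_setI finset.in_setT finset.in_set0.
apply/negP=> /afixP/(_ _ (cycle_id s)).
by rewrite /= apermE permE => /f_neq.
Qed.

Lemma dvdn_card_fset_set (T : choiceType) (A : set T) (f : T -> T) (p : nat) :
  prime p -> finite_set A -> (forall x, A x -> A (f x)) ->
  (forall x, A x -> iter p f x = x) -> (forall x, A x -> f x <> x) ->
  (p %| #|` fset_set A|%fset)%N.
Proof.
move=> p_pr finA fA fp f_neq; set S := fset_set A.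
have inS x : x \in S -> A x by rewrite in_fset_set // => /set_mem.
have fS (x : S) : f (val x) \in S.
  by rewrite in_fset_set //; apply/mem_set/fA/inS/valP.
pose g (x : S) : S := [` fS x]%fset.
have val_iter n x : val (iter n g x) = iter n f (val x).
  by elim: n => //= n ->.
rewrite cardfE; apply: (dvdn_card_fixpoint_free p_pr (f := g)) => x.
  by apply: val_inj; rewrite val_iter fp //; apply/inS/valP.
by move/(congr1 val); apply: f_neq; apply/inS/valP.
Qed.

Local Open Scope classical_set_scope.

(** * Ideals and their classes *)

Lemma same_quotient_close (r s n k : nat) : (0 < n)%N ->
  (r * k %/ n = s * k %/ n)%N -> `|r%:Z - s%:Z| * k%:Z < n%:Z.
Proof.
move=> n_gt0 eq_q.
have -> : `|r%:Z - s%:Z| * k%:Z = `|(r * k)%N%:Z - (s * k)%N%:Z|.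
  by rewrite !PoszM -mulrBl normrM (ger0_norm (_ : 0 <= k%:Z)).
rewrite (divn_eq (r * k) n) (divn_eq (s * k) n) eq_q.
have := ltn_pmod (r * k) n_gt0; have := ltn_pmod (s * k) n_gt0.
move: (_ %/ n * n)%N (r * k %% n)%N (s * k %% n)%N => {eq_q n_gt0} q a b; lia.
Qed.

(** Dirichlet's pigeonhole argument for [A / n] and [B / n]: the residues of [t * A] and [t * B]
    modulo [n] are sorted into [k.+1] cells each. *)
Lemma simultaneous_approximation (A B : int) (n k : nat) : (0 < n)%N ->
  exists t : nat, exists X Y : int, [/\ (0 < t <= k.+1 * k.+1)%N,
    `|t%:Z * A - n%:Z * X| * k.+1%:Z < n%:Z &
    `|t%:Z * B - n%:Z * Y| * k.+1%:Z < n%:Z].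
Proof.
move=> n_gt0.
have cell_lt (a : int) : (absz (a %% n%:Z)%Z * k.+1 %/ n < k.+1)%N.
  rewrite ltn_divLR // mulnC ltn_pmul2l //.
  have := ltz_pmod a (n_gt0 : 0 < n%:Z).
  by have := modz_ge0 a (lt0r_neq0 (n_gt0 : 0 < n%:Z)); lia.
pose cell a := Ordinal (cell_lt a).
have cellP a b : cell a = cell b ->
    `|(a - b) - n%:Z * ((a %/ n%:Z)%Z - (b %/ n%:Z)%Z)| * k.+1%:Z < n%:Z.
  move=> /(congr1 val) /= eq_cell.
  have := divz_eq a n%:Z; have := divz_eq b n%:Z.
  have := modz_ge0 a (lt0r_neq0 (n_gt0 : 0 < n%:Z)).
  have := modz_ge0 b (lt0r_neq0 (n_gt0 : 0 < n%:Z)).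
  move: eq_cell; set ra := (a %% _)%Z; set rb := (b %% _)%Z.
  set qa := (a %/ _)%Z; set qb := (b %/ _)%Z => eq_cell rb0 ra0 bE aE.
  have -> : (a - b) - n%:Z * (qa - qb) = ra - rb by rewrite aE bE; ring.
  by rewrite -[ra]gez0_abs // -[rb]gez0_abs //; apply: same_quotient_close.
(* There is one more index than pairs of cells; indices start at 0, so two of them differ by at most
   [k.+1 * k.+1]. *)
pose f (t : 'I_(k.+1 * k.+1).+1) := (cell (t%:Z * A), cell (t%:Z * B)).
have /injectivePn [t1 [t2 neq_t eq_f]] : ~~ injectiveb f.
  apply/negP=> /injectiveP/leq_card; rewrite card_prod !card_ord; lia.
have eqA := congr1 fst eq_f; have eqB := congr1 snd eq_f.
have main (s1 s2 : 'I_(k.+1 * k.+1).+1) : (s1 < s2)%N ->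
    cell (s1%:Z * A) = cell (s2%:Z * A) -> cell (s1%:Z * B) = cell (s2%:Z * B) ->
    exists t : nat, exists X Y : int, [/\ (0 < t <= k.+1 * k.+1)%N,
    `|t%:Z * A - n%:Z * X| * k.+1%:Z < n%:Z &
    `|t%:Z * B - n%:Z * Y| * k.+1%:Z < n%:Z].
  move=> lt_s /esym/cellP apA /esym/cellP apB.
  exists (s2 - s1)%N; do 2!eexists; split.
  - by rewrite subn_gt0 lt_s (leq_trans (leq_subr _ _)) // -ltnS.
  - by move: apA; rewrite -mulrBl -subzn ?(ltnW lt_s) //; apply.
  - by move: apB; rewrite -mulrBl -subzn ?(ltnW lt_s) //; apply.
case: (ltngtP t1 t2) => [lt_t|lt_t|/val_inj eq_t].
- exact: main lt_t eqA eqB.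
- exact: main lt_t (esym eqA) (esym eqB).
by rewrite eq_t eqxx in neq_t.
Qed.

Section QuadConj.

Variables (w : algC) (e : nat).
Hypotheses (w2 : w ^+ 2 = - e%:R) (e_gt0 : (0 < e)%N).

(** The conjugate has the same square as [w], and a real [w] would have a nonnegative square. *)
Lemma conj_quad_gen : w^* = - w.
Proof.
have : (w^*) ^+ 2 == w ^+ 2 by rewrite -rmorphXn w2 rmorphN /= conjC_nat.
rewrite eqf_sqr => /orP[/eqP w_real|/eqP//].
have : 0 <= w ^+ 2 by rewrite real_exprn_even_ge0 //; apply/CrealP.
by rewrite w2 oppr_ge0 lern0 eqn0Ngt e_gt0.
Qed.

Lemma normC_quad_int (a b : int) :
  `|a%:~R + b%:~R * w| ^+ 2 = (a ^+ 2 + e%:Z * b ^+ 2)%:~R.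
Proof.
rewrite normCK rmorphD rmorphM /= conj_quad_gen !rmorph_int.
transitivity (a%:~R ^+ 2 - b%:~R ^+ 2 * w ^+ 2); first by ring.
by rewrite w2; ring.
Qed.

Lemma normC_quad_int_nat z : quad_int w z -> exists n : nat, `|z| ^+ 2 = n%:R.
Proof.
move=> [a [b ->]]; exists (absz (a ^+ 2 + e%:Z * b ^+ 2)).
rewrite normC_quad_int pmulrn gez0_abs //.
by apply: addr_ge0; [|apply: mulr_ge0 => //]; apply: sqr_ge0.
Qed.

End QuadConj.

Section Ideals.

Variables (K : set algC) (w : algC) (e : nat).
Hypotheses (w2 : w ^+ 2 = - e%:R) (e_gt0 : (0 < e)%N).
Hypothesis OK_E : forall z, ring_of_integers K z <-> quad_int w z.

Local Notation O := (ring_of_integers K).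

Lemma OK1 : O 1. Proof. by apply/OK_E; apply: (quad_int_nat w 1). Qed.

Lemma OKM x y : O x -> O y -> O (x * y).
Proof. by rewrite !OK_E => ? ?; apply: (quad_intM w2). Qed.

Lemma OKX x n : O x -> O (x ^+ n).
Proof. by rewrite !OK_E => ?; apply: (quad_intX w2). Qed.

Lemma OKN x : O x -> O (- x).
Proof. by rewrite !OK_E => ?; apply: quad_intN. Qed.

Lemma nonzero_idealP I : nonzero_ideals K I -> exists2 x, I x & x != 0.
Proof.
move=> [[_ I0 _ _] I_neq0]; apply: contrapT => all0; apply: I_neq0.
apply/seteqP; split=> x /= => [Ix|-> //].
by apply: contrapT => /eqP x0; apply: all0; exists x.
Qed.

Lemma nonzero_idealI I x : is_ideal K I -> I x -> x != 0 -> nonzero_ideals K I.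
Proof.
by move=> idI Ix x0; split=> // I0; move: Ix x0; rewrite I0 /= => ->; rewrite eqxx.
Qed.

Lemma idealM I a x : is_ideal K I -> O a -> I x -> I (a * x).
Proof. by move=> [_ _ _]; apply. Qed.

Lemma idealD I x y : is_ideal K I -> I x -> I y -> I (x + y).
Proof. by move=> [_ _ + _]; apply. Qed.

Lemma idealN I x : is_ideal K I -> I x -> I (- x).
Proof. by move=> idI Ix; rewrite -mulN1r; apply: idealM => //; apply/OKN/OK1. Qed.

(** Squared absolute values on [I] are natural numbers. A minimal vector serves both for the
    multipliers preserving [I] and for the finiteness of the classes. *)
Lemma ideal_min_norm I : nonzero_ideals K I ->
  exists j, [/\ I j, j != 0 & forall x, I x -> x != 0 -> `|j| <= `|x|].
Proof.
move=> nzI; have [x Ix x0] := nonzero_idealP nzI; have [[subO _ _ _] _] := nzI.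
pose P n := `[< exists z, [/\ I z, z != 0 & `|z| ^+ 2 = n%:R] >].
have norm_nat z : I z -> exists n : nat, `|z| ^+ 2 = n%:R.
  by move/subO/OK_E/(normC_quad_int_nat w2 e_gt0).
have exP : exists n, P n.
  by have [n xn] := norm_nat x Ix; exists n; apply/asboolP; exists x.
case: (ex_minnP exP) => n /asboolP[j [Ij j0 jn]] min_n.
exists j; split=> // z Iz z0; have [k zk] := norm_nat z Iz.
rewrite -(ler_pXn2r (isT : (0 < 2)%N)) ?nnegrE //= jn zk ler_nat.
by apply: min_n; apply/asboolP; exists z.
Qed.

Local Notation scale a I := [set (a : algC) * x | x in (I : set algC)].

Lemma scaleM (a b : algC) (I : set algC) : scale a (scale b I) = scale (a * b) I.
Proof.
apply/seteqP; split=> z /= [].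
  by move=> _ [x Ix <-] <-; exists x => //; rewrite mulrA.
by move=> x Ix <-; exists (b * x); [exists x | rewrite mulrA].
Qed.

Lemma ideal_equiv_refl I : ideal_equiv K I I.
Proof. by exists 1, 1; split; rewrite ?oner_neq0 //; apply: OK1. Qed.

Lemma ideal_equiv_sym I J : ideal_equiv K I J -> ideal_equiv K J I.
Proof. by move=> [a [b [? ? ? ? eqIJ]]]; exists b, a. Qed.

Lemma ideal_equiv_trans I J L :
  ideal_equiv K I J -> ideal_equiv K J L -> ideal_equiv K I L.
Proof.
move=> [a [b [Oa Ob a0 b0 eqIJ]]] [c [d [Oc Od c0 d0 eqJL]]].
exists (c * a), (b * d); split; rewrite ?mulf_neq0 //; try exact: OKM.
by rewrite -!scaleM eqIJ -eqJL !scaleM mulrC.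
Qed.

Lemma ideal_class_eqP I J : nonzero_ideals K J ->
  ideal_class K I = ideal_class K J <-> ideal_equiv K I J.
Proof.
move=> nzJ; split=> [eq_cl|eqIJ].
  have : ideal_class K J J by split=> //; apply: ideal_equiv_refl.
  by rewrite -eq_cl => -[].
apply/seteqP; split=> L [nzL eqL]; split=> //; apply: ideal_equiv_trans eqL => //.
exact: ideal_equiv_sym.
Qed.

(* The elements [x - 1], [x + 1] and [x ^+ 2 + 1 = (x + x^* ) * x] map a minimal
   vector of the ideal into the ideal, hence are zero or of norm at least 1;
   if [x] is not 1 or -1, this leaves only -1, 0 and 1 for the trace of [x]. *)
Lemma scale_ideal_id I x : is_subfield K -> (1 < e)%N -> nonzero_ideals K I ->
  scale x I = I -> x = 1 \/ x = - 1.
Proof.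
move=> subK e_gt1 nzI xI; have [idI _] := nzI.
have [j [Ij j0 min_j]] := ideal_min_norm nzI.
have Ix z : I z -> I (x * z) by rewrite -{2}xI => Iz; exists z.
have big g : I (g * j) -> g = 0 \/ 1 <= `|g|.
  move=> Igj; have [->|g0] := eqVneq g 0; [by left | right].
  have := min_j _ Igj (mulf_neq0 g0 j0).
  by rewrite normrM ler_pMl ?normr_gt0.
have [x0 x_ge1] : x != 0 /\ 1 <= `|x|.
  have [x0|//] := big x (Ix _ Ij).
    have := Ij; rewrite -xI => -[z _]; rewrite x0 mul0r => j_0.
    by rewrite -j_0 eqxx in j0.
  by move=> x_ge1; split=> //; rewrite -normr_gt0 (lt_le_trans _ x_ge1).
(* [x] maps [I] onto [I]: as [j = x * z] with [z] no shorter than [j], the opposite bound [|x| <= 1]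
   follows. *)
have [z Iz xz] : exists2 z, I z & x * z = j by move: Ij; rewrite -{1}xI.
have x_norm : `|x| = 1.
  apply/eqP; rewrite eq_le x_ge1 andbT.
  have z0 : z != 0 by apply: contraNneq j0 => z0; rewrite -xz z0 mulr0.
  have := min_j _ Iz z0; rewrite -{1}xz normrM.
  by rewrite ger_pMl ?normr_gt0.
have xxC : x * x^* = 1 by rewrite -normCK x_norm expr1n.
have [->|x_neq1] := eqVneq x 1; first by left.
have [->|x_neqN1] := eqVneq x (-1); first by right.
pose T := x + x^*.
have T_real : T \is Num.real by apply/CrealP; rewrite /T rmorphD /= conjCK addrC.
have T_le1 : T <= 1.
  have Ig : I ((x - 1) * j).
    by rewrite mulrBl mul1r; apply: idealD (Ix _ Ij) (idealN idI Ij).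
  have [/eqP|] := big _ Ig; first by rewrite subr_eq0 (negPf x_neq1).
  rewrite -(ler_pXn2r (isT : (0 < 2)%N)) ?nnegrE // expr1n normCK rmorphB /= rmorph1.
  have -> : (x - 1) * (x^* - 1) = x * x^* + 1 - T by rewrite /T; ring.
  by rewrite xxC lerBrDr -lerBrDl addrK.
have T_geN1 : - 1 <= T.
  have Ig : I ((x + 1) * j).
    by rewrite mulrDl mul1r; apply: idealD (Ix _ Ij) Ij.
  have [/eqP|] := big _ Ig; first by rewrite addr_eq0 (negPf x_neqN1).
  rewrite -(ler_pXn2r (isT : (0 < 2)%N)) ?nnegrE // expr1n normCK rmorphD /= rmorph1.
  have -> : (x + 1) * (x^* + 1) = x * x^* + 1 + T by rewrite /T; ring.
  by rewrite xxC -addrA lerDl addrC -lerBlDr sub0r.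
have quad : x ^+ 2 + 1 = T * x.
  by rewrite -xxC /T; ring.
(* The conjugate of [x] is its inverse and sends [j] to [z], so [T * j] lies in [I]. *)
have [t Tt] : exists t : int, T = t%:~R.
  have Ig : I (T * j).
    rewrite mulrDl -{2}xz mulrA [x^* * x]mulrC xxC mul1r.
    exact: idealD (Ix _ Ij) Iz.
  have [T0|] := big _ Ig; first by exists 0.
  rewrite real_ler_normr // => /orP[T_ge1|T_leN1].
    by exists 1; apply/eqP; rewrite eq_le T_le1.
  by exists (-1); apply/eqP; rewrite eq_le T_geN1 lerNr T_leN1.
have xAint : x \in Aint.
  apply: (@root_monic_Aint ('X^2 - (t%:~R *: 'X - 1))).
  - rewrite /root !hornerE; apply/eqP; transitivity (x ^+ 2 + 1 - T * x).
      by rewrite Tt; ring.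
    by rewrite quad subrr.
  - rewrite monicE lead_coefDl ?lead_coefXn // size_polyXn size_polyN.
    by rewrite (leq_ltn_trans (size_polyD _ _)) // gtn_max ltnS size_polyN
      size_poly1 (leq_trans (size_scale_leq _ _)) ?size_polyX.
  - apply/polyOverP=> i; rewrite coefB coefB coefXn coefZ coefX coef1.
    by rewrite !rpredB ?rpredM ?rpred_nat ?intr_int.
have [subO _ _ _] := idI.
have [Kj _] := subO _ Ij; have [Kxj _] := subO _ (Ix _ Ij).
have Kx : K x.
  have [_ _ Kdiv] := subK.
  by have /set_mem := Kdiv _ _ (mem_set Kxj) (mem_set Kj); rewrite mulfK.
have /OK_E[a [b xE]] : O x by split.
have := normC_quad_int w2 e_gt0 a b; rewrite -xE x_norm expr1n => /eqP.
rewrite -[1]/(1%:~R) eqr_int => /eqP eq1.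
have b0 : b = 0 by nia.
have : a = 1 \/ a = -1 by nia.
by rewrite xE b0 mul0r addr0 => -[] ->; [left | right].
Qed.

(** * Finiteness of the set of ideal classes *)

(** Approximating the coordinates of [y / j] with [k = e] makes [t * y - c * j] strictly shorter
    than [j]: its relative squared length is at most [(1 + e) / (e + 1) ^ 2]. By minimality it is
    zero. *)
Lemma ideal_bounded_multiple I j y : nonzero_ideals K I ->
  I j -> j != 0 -> (forall x, I x -> x != 0 -> `|j| <= `|x|) -> I y ->
  exists2 t : nat, (0 < t <= e.+1 * e.+1)%N & exists2 c, O c & t%:R * y = c * j.
Proof.
move=> nzI Ij j0 min_j Iy; have [idI _] := nzI; have [subO _ _ _] := idI.
have conj_j : quad_int w j^*.
  have /OK_E[a [b ->]] := subO _ Ij; exists a, (- b).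
  rewrite rmorphD rmorphM /= (conj_quad_gen w2 e_gt0) !rmorph_int; ring.
have [n nE] := normC_quad_int_nat w2 e_gt0 (proj1 (OK_E _) (subO _ Ij)).
have n_gt0 : (0 < n)%N by rewrite -(ltr0n algC) -nE exprn_gt0 ?normr_gt0.
have [A [B yE]] : quad_int w (y * j^*).
  by apply: (quad_intM w2) => //; apply/OK_E/subO.
have [t [X [Y [t_le apX apY]]]] := simultaneous_approximation A B e n_gt0.
exists t => //; exists (X%:~R + Y%:~R * w); first by apply/OK_E; exists X, Y.
set c := X%:~R + _; apply/eqP; rewrite -subr_eq0; apply/negPn/negP => z0.
have Oc : O c by apply/OK_E; exists X, Y.
have Iz : I (t%:R * y - c * j).
  apply: idealD => //; [|apply: idealN => //]; apply: idealM => //.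
  by apply/OK_E/quad_int_nat.
have := min_j _ Iz z0.
rewrite -(ler_pXn2r (isT : (0 < 2)%N)) ?nnegrE // nE => le_n.
have zE : (t%:R * y - c * j) * j^* =
    (t%:Z * A - n%:Z * X)%:~R + (t%:Z * B - n%:Z * Y)%:~R * w.
  rewrite mulrBl -mulrA yE -mulrA -normCK nE /c; ring.
have := normC_quad_int w2 e_gt0 (t%:Z * A - n%:Z * X) (t%:Z * B - n%:Z * Y).
rewrite -zE normrM norm_conjC exprMn nE => normE.
have : (n%:R * n%:R : algC) <=
    ((t%:Z * A - n%:Z * X) ^+ 2 + e%:Z * (t%:Z * B - n%:Z * Y) ^+ 2)%:~R.
  by rewrite -normE ler_wpM2r.
rewrite -[n%:R]/(n%:Z%:~R) -intrM ler_int.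
set P := t%:Z * A - _ in apX *; set Q := t%:Z * B - _ in apY *.
have sq_bound (x : int) : `|x| * e.+1%:Z < n%:Z -> x ^+ 2 * e.+1%:Z ^+ 2 <= n%:Z ^+ 2.
  move=> lt_x; rewrite -[x ^+ 2]real_normK ?num_real // -exprMn.
  by apply: lerXn2r; rewrite ?nnegrE ?mulr_ge0 // ltW.
move: (sq_bound _ apX) (sq_bound _ apY) => P2 Q2 le_PQ.
have : e.+1%:Z ^+ 2 * (n%:Z * n%:Z) <= e.+1%:Z * n%:Z ^+ 2.
  apply: le_trans (_ : e.+1%:Z ^+ 2 * (P ^+ 2 + e%:Z * Q ^+ 2) <= _).
    by apply: ler_wpM2l.
  have -> : e.+1%:Z ^+ 2 * (P ^+ 2 + e%:Z * Q ^+ 2) =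
    P ^+ 2 * e.+1%:Z ^+ 2 + e%:Z * (Q ^+ 2 * e.+1%:Z ^+ 2) by ring.
  have -> : e.+1%:Z * n%:Z ^+ 2 = n%:Z ^+ 2 + e%:Z * n%:Z ^+ 2.
    by rewrite -[e.+1]add1n PoszD; ring.
  by apply: lerD => //; apply: ler_wpM2l.
rewrite -expr2 ler_pM2r ?exprn_gt0 // expr2 ger_pMl // lez_nat.
by rewrite ltnS leqNgt e_gt0.
Qed.

(** [J] is [I] scaled by [N / j], with [j] minimal and [N] the factorial. Every admissible [t]
    divides [N], so [J] stays integral; [j] is sent to [N]. *)
Lemma ideal_equiv_containing I : nonzero_ideals K I ->
  exists J, [/\ nonzero_ideals K J, ideal_equiv K I J &
    J ((e.+1 * e.+1)`!)%:R].
Proof.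
move=> nzI; have [idI _] := nzI; have [j [Ij j0 min_j]] := ideal_min_norm nzI.
have [subO I0 _ _] := idI; set N := ((_)`!)%N.
have ON : O N%:R by apply/OK_E/quad_int_nat.
have N0 : N%:R != 0 :> algC by rewrite pnatr_eq0 -lt0n fact_gt0.
pose J := [set z | exists2 y, I y & z = N%:R * y / j].
have JN : J N%:R by exists j => //; rewrite mulfK.
have idJ : is_ideal K J.
  split.
  - move=> _ [y Iy ->].
    have [t /andP[t_gt0 t_le] [c Oc tyE]] := ideal_bounded_multiple nzI Ij j0 min_j Iy.
    have -> : N%:R * y / j = (N %/ t)%:R * c.
      rewrite -[N](@divnK t) ?dvdn_fact ?t_gt0 // natrM -[_ * t%:R * y]mulrA tyE.
      by rewrite !mulrA mulfK // mulnK.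
    by apply: OKM => //; apply/OK_E/quad_int_nat.
  - by exists 0 => //; rewrite mulr0 mul0r.
  - move=> _ _ [x Ix ->] [y Iy ->]; exists (x + y); first exact: idealD.
    by ring.
  - move=> a _ Oa [x Ix ->]; exists (a * x); first exact: idealM.
    by ring.
exists J; split=> //; first exact: nonzero_idealI JN N0.
exists N%:R, j; split=> //; first exact: subO.
apply/seteqP; split=> z /=.
  move=> [y Iy <-]; exists (N%:R * y / j); first by exists y.
  by rewrite mulrC divfK.
by move=> [_ [y Iy ->] <-]; exists y => //; rewrite [RHS]mulrC divfK.
Qed.

(** Such an ideal is a union of cosets modulo [N], hence determined by the residues [a + b * w] with
    [a, b < N] that it contains. *)
Lemma finite_ideals_containing (N : nat) : (0 < N)%N ->
  finite_set [set J | nonzero_ideals K J /\ J N%:R].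
Proof.
move=> N_gt0.
pose G (S : {set 'I_N * 'I_N}) : set algC :=
  [set z | exists ab, ab \in S /\ exists2 u, O u &
     z = (nat_of_ord ab.1)%:R + (nat_of_ord ab.2)%:R * w + N%:R * u].
apply: (@sub_finite_set _ _ (range G)); last exact/finite_image/finite_finset.
move=> J [[idJ _] JN]; have [subO _ _ _] := idJ.
exists [set ab : 'I_N * 'I_N |
  `[< J ((nat_of_ord ab.1)%:R + (nat_of_ord ab.2)%:R * w) >]]%SET => //.
have JNu u : O u -> J (N%:R * u) by move=> Ou; rewrite mulrC; apply: idealM.
apply/seteqP; split=> z.
  move=> [ab [+ [u Ou ->]]]; rewrite finset.inE => /asboolP Jab.
  by apply: idealD => //; apply: JNu.
move=> Jz; have /OK_E[a [b zE]] := subO _ Jz.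
have modN (c : int) : exists i : 'I_N, exists q : int, c = i%:Z + N%:Z * q.
  have r_ge0 : 0 <= (c %% N%:Z)%Z by rewrite modz_ge0 // -lt0n.
  have r_lt : (absz (c %% N%:Z)%Z < N)%N.
    by have := ltz_pmod c (N_gt0 : 0 < N%:Z); rewrite -{1}[(_ %% _)%Z]gez0_abs.
  exists (Ordinal r_lt), (c %/ N%:Z)%Z; rewrite /= gez0_abs //.
  by rewrite {1}(divz_eq c N%:Z); ring.
have [i [q aE]] := modN a; have [i' [q' bE]] := modN b.
have Ou : O (q%:~R + q'%:~R * w) by apply/OK_E; exists q, q'.
have zE' : z = (nat_of_ord i)%:R + (nat_of_ord i')%:R * w
               + N%:R * (q%:~R + q'%:~R * w).
  by rewrite zE aE bE; ring.
exists (i, i'); split; last by exists (q%:~R + q'%:~R * w).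
rewrite finset.inE /=; apply/asboolP.
have -> : (nat_of_ord i)%:R + (nat_of_ord i')%:R * w
          = z - N%:R * (q%:~R + q'%:~R * w) by rewrite zE'; ring.
by apply: idealD => //; apply: idealN => //; apply: JNu.
Qed.

Lemma ideal_classes_finite : finite_set (ideal_classes K).
Proof.
have := finite_image (ideal_class K)
  (finite_ideals_containing (fact_gt0 (e.+1 * e.+1))).
apply: sub_finite_set => _ [I nzI <-].
have [J [nzJ eqIJ JN]] := ideal_equiv_containing nzI.
by exists J => //; apply/esym/ideal_class_eqP.
Qed.

(** * Multiplication by a two-generator ideal *)

Definition twist (g b : algC) (I : set algC) : set algC :=
  [set z | exists x y, [/\ I x, I y & z = g * x + b * y]].

Lemma twist_sub g b I : O g -> O b -> is_ideal K I -> twist g b I `<=` I.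
Proof.
by move=> Og Ob idI _ [x [y [Ix Iy ->]]]; apply: idealD => //; apply: idealM.
Qed.

Lemma twist_ideal g b I : O g -> O b -> is_ideal K I -> is_ideal K (twist g b I).
Proof.
move=> Og Ob idI; have [subO I0 _ _] := idI; split.
- by move=> z /(twist_sub Og Ob idI)/subO.
- by exists 0, 0; split=> //; rewrite !mulr0 addr0.
- move=> _ _ [x [y [Ix Iy ->]]] [x' [y' [Ix' Iy' ->]]].
  by exists (x + x'), (y + y'); split; [exact: idealD | exact: idealD | ring].
- move=> a _ Oa [x [y [Ix Iy ->]]].
  by exists (a * x), (a * y); split; [exact: idealM | exact: idealM | ring].
Qed.

Lemma twist_nonzero g b I : O g -> O b -> b != 0 -> nonzero_ideals K I ->
  nonzero_ideals K (twist g b I).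
Proof.
move=> Og Ob b0 nzI; have [idI _] := nzI; have [_ I0 _ _] := idI.
have [x Ix x0] := nonzero_idealP nzI.
apply: (@nonzero_idealI _ (b * x)); [exact: twist_ideal | | exact: mulf_neq0].
by exists 0, x; split=> //; rewrite mulr0 add0r.
Qed.

Lemma twist_scale g b a I : twist g b (scale a I) = scale a (twist g b I).
Proof.
apply/seteqP; split=> z /=.
  move=> [_ [_ [[x Ix <-] [y Iy <-] ->]]].
  by exists (g * x + b * y); [exists x, y | ring].
move=> [_ [x [y [Ix Iy ->]]] <-].
by exists (a * x), (a * y); split; [exists x | exists y | ring].
Qed.

Lemma iter_twist_ideal g b I n : O g -> O b -> is_ideal K I ->
  is_ideal K (iter n (twist g b) I).
Proof. by move=> Og Ob idI; elim: n => //= n IHn; apply: twist_ideal. Qed.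

(** Of the products of [n] factors [g] or [b], all but [g ^+ n] contain [b]; the cofactor is
    absorbed by [I]. *)
Lemma iter_twist_sub g b I n : O g -> O b -> is_ideal K I ->
  iter n (twist g b) I `<=` twist (g ^+ n) b I.
Proof.
move=> Og Ob idI; have [_ I0 _ _] := idI; elim: n => [|n IHn] z.
  by exists z, 0; split=> //; rewrite expr0; ring.
have sub : iter n (twist g b) I `<=` I.
  by apply: subset_trans IHn _; apply: twist_sub => //; apply: OKX.
move=> [_ [y [/IHn[x [t [Ix It ->]]] /sub Iy ->]]].
exists x, (g * t + y); split=> //; last by rewrite exprS; ring.
by apply: idealD => //; apply: idealM.
Qed.

Lemma iter_twist_powl g b I n x : O g -> O b -> is_ideal K I -> I x ->
  iter n (twist g b) I (g ^+ n * x).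
Proof.
move=> Og Ob idI Ix; elim: n => [|n IHn]; first by rewrite mul1r.
have [_ I0 _ _] := iter_twist_ideal n Og Ob idI.
by exists (g ^+ n * x), 0; split=> //; rewrite exprS; ring.
Qed.

Lemma iter_twist_powr g b I n x : O g -> O b -> is_ideal K I -> I x ->
  iter n (twist g b) I (b ^+ n * x).
Proof.
move=> Og Ob idI Ix; elim: n => [|n IHn]; first by rewrite mul1r.
have [_ I0 _ _] := iter_twist_ideal n Og Ob idI.
by exists 0, (b ^+ n * x); split=> //; rewrite exprS; ring.
Qed.

(* [twist g b] multiplies by the ideal [(g, b)], whose [n.+1]-th power is [(b)]
   under these hypotheses. *)
Lemma iter_twist_principal g b b' u v I n :
  O g -> O b -> O b' -> O u -> O v -> is_ideal K I ->
  g ^+ n.+1 = b * b' -> 1 = u * b' + v * b ^+ n ->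
  iter n.+1 (twist g b) I = scale b I.
Proof.
move=> Og Ob Ob' Ou Ov idI gE bez; apply/seteqP; split=> z.
  move=> /(iter_twist_sub Og Ob idI)[x [y [Ix Iy ->]]].
  exists (b' * x + y); last by rewrite gE; ring.
  by apply: idealD => //; apply: idealM.
move=> [x Ix <-].
have -> : b * x = g ^+ n.+1 * (u * x) + b ^+ n.+1 * (v * x).
  by rewrite -[LHS]mul1r {1}bez gE exprS; ring.
have idF := iter_twist_ideal n.+1 Og Ob idI.
by apply: (idealD idF); [apply: iter_twist_powl | apply: iter_twist_powr] => //;
  apply: idealM.
Qed.

Lemma twist_equiv g b I J :
  ideal_equiv K I J -> ideal_equiv K (twist g b I) (twist g b J).
Proof.
move=> [x [y [Ox Oy x0 y0 eqIJ]]]; exists x, y; split=> //.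
by rewrite -!twist_scale eqIJ.
Qed.

(** All members of [C] are multiplied and the result is saturated under equivalence, so no
    representative has to be chosen. *)
Definition class_twist (g b : algC) (C : set (set algC)) : set (set algC) :=
  [set J | nonzero_ideals K J /\ exists2 I, C I & ideal_equiv K (twist g b I) J].

Lemma class_twistE g b I : nonzero_ideals K I ->
  class_twist g b (ideal_class K I) = ideal_class K (twist g b I).
Proof.
move=> nzI; apply/seteqP; split=> J [nzJ].
  move=> [L [nzL eqIL] eqLJ]; split=> //; apply: ideal_equiv_trans eqLJ.
  exact: twist_equiv.
by move=> eqIJ; split=> //; exists I => //; split=> //; apply: ideal_equiv_refl.
Qed.

Lemma scale_iter_twist g b x y I n :
  scale x (twist g b I) = scale y I ->
  scale (x ^+ n) (iter n (twist g b) I) = scale (y ^+ n) I.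
Proof.
move=> eqxy; elim: n => [//|n IHn].
rewrite exprS -scaleM /= -twist_scale IHn twist_scale scaleM mulrC -scaleM eqxy.
by rewrite scaleM -exprSr.
Qed.

(** [class_twist] has period [p], since [p] products by [(g, b)] amount to scaling by [b]. On a
    fixed class, scaling [I] by [x ^+ p * b] or by [y ^+ p] gives the same set, so these agree up to
    a sign, which the odd power absorbs. *)
Lemma dvdn_class_number p g b b' u v :
  is_subfield K -> (1 < e)%N -> finite_set (ideal_classes K) ->
  prime p -> odd p -> O g -> O b -> O b' -> O u -> O v -> b != 0 ->
  g ^+ p = b * b' -> 1 = u * b' + v * b ^+ p.-1 ->
  (forall x y, O x -> O y -> x != 0 -> y != 0 -> b * x ^+ p <> y ^+ p) ->
  (p %| class_number K)%N.
Proof.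
move=> subK e_gt1 fin_cl p_pr p_odd Og Ob Ob' Ou Ov b0 gE bez not_pow.
have pE : p = p.-1.+1 by rewrite prednK ?prime_gt0.
have iter_p I : is_ideal K I -> iter p (twist g b) I = scale b I.
  by move=> idI; rewrite pE; apply: iter_twist_principal bez => //; rewrite -pE.
have iter_nz n I : nonzero_ideals K I -> nonzero_ideals K (iter n (twist g b) I).
  by move=> nzI; elim: n => //= n; apply: twist_nonzero.
apply: (dvdn_card_fset_set p_pr fin_cl (f := class_twist g b)) => _ [I nzI <-].
- by rewrite class_twistE //; exists (twist g b I) => //; apply: (iter_nz 1%N).
- have -> n : iter n (class_twist g b) (ideal_class K I) =
              ideal_class K (iter n (twist g b) I).
    by elim: n => //= n ->; rewrite class_twistE //; apply: iter_nz.
  apply/ideal_class_eqP => //; have [idI _] := nzI; rewrite iter_p //.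
  exists 1, b; split; rewrite ?oner_neq0 //; first exact: OK1.
  by rewrite scaleM mul1r.
rewrite class_twistE // => /(ideal_class_eqP _ nzI)[x [y [Ox Oy x0 y0 eqxy]]].
have := scale_iter_twist p eqxy; have [idI _] := nzI.
rewrite iter_p // scaleM => eqI.
have y0p : y ^+ p != 0 by rewrite expf_neq0.
have := congr1 (fun J => scale (y ^+ p)^-1 J) eqI.
rewrite /= !scaleM mulVf // => eqI'.
have [] := scale_ideal_id subK e_gt1 nzI (x := (y ^+ p)^-1 * (x ^+ p * b)).
- rewrite eqI'; apply/seteqP; split=> z /=; first by case=> t It <-; rewrite mul1r.
  by exists z => //; rewrite mul1r.
- move/(canRL (mulVKf y0p)); rewrite mulr1 mulrC.
  exact: not_pow.
move/(canRL (mulVKf y0p)); rewrite mulrN1 mulrC.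
have -> : - y ^+ p = (- y) ^+ p by rewrite exprNn -signr_odd p_odd mulN1r.
by apply: not_pow; rewrite ?oppr_eq0 //; apply: OKN.
Qed.

End Ideals.

(** * The ring of integers *)

Lemma square_factorization (n : nat) : (0 < n)%N ->
  exists t e : nat, n = (t ^ 2 * e)%N /\ (forall k, (k ^ 2 %| e)%N -> k = 1%N).
Proof.
elim/ltn_ind: n => n IHn n_gt0.
have [[k [k_gt1 /dvdnP[n' nE]]]|no_k] :=
    pselect (exists k, (1 < k)%N /\ (k ^ 2 %| n)%N).
  have n'_gt0 : (0 < n')%N by move: n_gt0; rewrite nE muln_gt0 => /andP[].
  have lt_n' : (n' < n)%N.
    by rewrite nE ltn_Pmulr // -[1%N](exp1n 2) ltn_exp2r.
  have [t [e [n'E sqf]]] := IHn _ lt_n' n'_gt0.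
  by exists (k * t)%N, e; split=> //; rewrite nE n'E expnMn mulnC mulnA.
exists 1%N, n; split=> [|k k2]; first by rewrite mul1n.
case: k k2 => [|[|k]] // k2; first by move: k2 n_gt0; rewrite dvd0n => /eqP->.
by case: no_k; exists k.+2.
Qed.

(** In lowest terms, the square of the denominator is coprime to the numerator, so it divides
    [e]. *)
Lemma Crat_sqrt_int (e : nat) (x : algC) : (forall k, (k ^ 2 %| e)%N -> k = 1%N) ->
  x \in Crat -> e%:R * x ^+ 2 \in Num.int -> x \in Num.int.
Proof.
move=> sqf /CratP[r ->] /intrP[M eM].
have d0 : (denq r)%:~R != 0 :> algC by rewrite intr_eq0 denq_neq0.
have ratrE : ratr r = (numq r)%:~R / (denq r)%:~R :> algC by [].
have eq_int : e%:Z * numq r ^+ 2 = M * denq r ^+ 2.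
  apply: (@intr_inj algC).
  transitivity (M%:~R * (denq r)%:~R ^+ 2 : algC); last by ring.
  by rewrite -eM ratrE; field.
have d1 : absz (denq r) = 1%N.
  apply: sqf; rewrite -(@Gauss_dvdl _ _ (absz (numq r) ^ 2)).
    by rewrite -!abszX -[e]/(absz e%:Z) -abszM eq_int abszM dvdn_mull.
  by rewrite coprimeXl // coprimeXr // coprime_sym coprime_num_den.
by rewrite ratrE -[denq r]gez0_abs ?denq_ge0 // d1 divr1 intr_int.
Qed.

(** The minimal polynomial of [x ^+ n], composed with [X^n], is monic and integral and vanishes at
    [x]. *)
Lemma Aint_expr (n : nat) (x : algC) : (0 < n)%N -> x ^+ n \in Aint -> x \in Aint.
Proof.
move=> n_gt0 Axn; pose P := minCpoly (x ^+ n).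
apply: (@root_monic_Aint (P \Po 'X^n)).
- by rewrite /root horner_comp hornerXn; apply: root_minCpoly.
- rewrite monicE lead_coef_comp ?size_polyXn ?ltnS // lead_coefXn expr1n mulr1.
  exact: minCpoly_monic.
- by apply: polyOver_comp => //; rewrite rpredX // polyOverX.
Qed.

Lemma is_subfield_Qadj z : is_subfield (Qadj z).
Proof.
split.
- by apply/mem_set => F [[F1 _ _] _]; apply/set_mem.
- move=> x y /set_mem Kx /set_mem Ky; apply/mem_set => F FF; have [[_ FB _] _] := FF.
  by apply/set_mem/FB; apply/mem_set; [apply: Kx | apply: Ky].
- move=> x y /set_mem Kx /set_mem Ky; apply/mem_set => F FF; have [[_ _ Fdiv] _] := FF.
  by apply/set_mem/Fdiv; apply/mem_set; [apply: Kx | apply: Ky].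
Qed.

Lemma Qadj_sub F z : is_subfield F -> F z -> Qadj z `<=` F.
Proof. by move=> subF Fz x /(_ F); apply; split=> // _ ->. Qed.

Lemma Qadj_id z : Qadj z z.
Proof. by move=> F [_]; apply. Qed.

Section Subfield.

Variable F : set algC.
Hypothesis subF : is_subfield F.

Lemma subfieldB x y : F x -> F y -> F (x - y).
Proof. by have [_ FB _] := subF => Fx Fy; apply/set_mem/FB; apply/mem_set. Qed.

Lemma subfield_div x y : F x -> F y -> F (x / y).
Proof. by have [_ _ Fd] := subF => Fx Fy; apply/set_mem/Fd; apply/mem_set. Qed.

Lemma subfield1 : F 1. Proof. by have [/set_mem] := subF. Qed.

Lemma subfieldN x : F x -> F (- x).
Proof.
by move=> Fx; rewrite -sub0r -(subrr x); apply: subfieldB => //; apply: subfieldB.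
Qed.

Lemma subfieldD x y : F x -> F y -> F (x + y).
Proof. by move=> Fx /subfieldN/(subfieldB Fx); rewrite opprK. Qed.

Lemma subfieldM x y : F x -> F y -> F (x * y).
Proof.
move=> Fx Fy; have := subfield_div Fx (subfield_div subfield1 Fy).
by rewrite div1r invrK.
Qed.

Lemma subfieldX x n : F x -> F (x ^+ n).
Proof.
move=> Fx; elim: n => [|n IHn]; first exact: subfield1.
by rewrite exprS; apply: subfieldM.
Qed.

Lemma subfield_nat (n : nat) : F n%:R.
Proof.
elim: n => [|n IHn].
  by rewrite -[0%:R](subrr (1 : algC)); apply: subfieldB; apply: subfield1.
by rewrite -natr1; apply: subfieldD => //; apply: subfield1.
Qed.

Lemma subfield_int (n : int) : F n%:~R.
Proof.
case: n => n; first exact: subfield_nat.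
by rewrite NegzE rmorphN; apply/subfieldN/subfield_nat.
Qed.

End Subfield.

Section QuadraticField.

Variables (w : algC) (e t : nat).
Hypotheses (w2 : w ^+ 2 = - e%:R) (e_gt0 : (0 < e)%N) (t_gt0 : (0 < t)%N).

Local Notation K := (Qadj (t%:R * w)).

Let subK : is_subfield K := is_subfield_Qadj _.

Lemma Qadj_gen : K w.
Proof.
have t0 : t%:R != 0 :> algC by rewrite pnatr_eq0 -lt0n.
have := subfield_div subK (@Qadj_id _) (subfield_nat subK t).
by rewrite mulrAC divff // mul1r.
Qed.

(** The numbers [a + b * w] form a field containing [t * w]: inverses are conjugates divided by the
    rational norm. *)
Lemma Qadj_quadratic x : K x ->
  exists a b, [/\ a \in Crat, b \in Crat & x = a + b * w].
Proof.
pose F := [set x | exists a b, [/\ a \in Crat, b \in Crat & x = a + b * w]].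
suff subF : is_subfield F.
  move=> Kx; apply: (Qadj_sub subF _ Kx); exists 0, t%:R.
  split; rewrite ?rpred0 ?rpred_nat //.
  by rewrite add0r.
have FM y z : F y -> F z -> F (y * z).
  move=> [a [b [Qa Qb ->]]] [c [d [Qc Qd ->]]].
  exists (a * c - e%:R * b * d), (a * d + b * c); split.
  - by rewrite rpredB ?rpredM ?rpred_nat.
  - by rewrite rpredD ?rpredM.
  transitivity (a * c + (a * d + b * c) * w + b * d * w ^+ 2); first by ring.
  by rewrite w2; ring.
split.
- apply/mem_set; exists 1, 0; split; rewrite ?rpred1 ?rpred0 //; ring.
- move=> _ _ /set_mem[a [b [Qa Qb ->]]] /set_mem[c [d [Qc Qd ->]]].
  by apply/mem_set; exists (a - c), (b - d); split; rewrite ?rpredB //; ring.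
move=> x' y /set_mem Fx /set_mem Fy; apply/mem_set/FM => //.
have [->|y0] := eqVneq y 0.
  by rewrite invr0; exists 0, 0; split; rewrite ?rpred0 //; ring.
have [a [b [Qa Qb yE]]] := Fy.
have yC : y^* = a - b * w.
  by rewrite yE rmorphD rmorphM /= (conj_quad_gen w2 e_gt0) !conj_Crat //; ring.
have normy : y * y^* = a ^+ 2 + e%:R * b ^+ 2.
  rewrite yC yE; transitivity (a ^+ 2 - b ^+ 2 * w ^+ 2); first by ring.
  by rewrite w2; ring.
have n0 : y * y^* != 0 by rewrite mulf_neq0 ?conjC_eq0.
exists (a / (y * y^*)), (- b / (y * y^*)); split.
- by rewrite rpred_div // normy rpredD ?rpredM ?rpredX ?rpred_nat.
- by rewrite rpred_div ?rpredN // normy rpredD ?rpredM ?rpredX ?rpred_nat.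
have -> : a / (y * y^*) + - b / (y * y^*) * w = (a - b * w) / (y * y^*) by ring.
by rewrite -yC invfM mulrCA divff ?mulr1 // conjC_eq0.
Qed.

(** [A = 2 * a] and the norm [M] are integers, and so is [B = 2 * b], as
    [e * B ^+ 2 = 4 * M - A ^+ 2] with [e] squarefree. Since [e] is 1 modulo 4, [A ^+ 2 + B ^+ 2] is
    0 modulo 4, so [A] and [B] are even. *)
Lemma ring_of_integers_Qadj z :
  (forall k, (k ^ 2 %| e)%N -> k = 1%N) -> (e %% 4 = 1)%N ->
  ring_of_integers K z <-> quad_int w z.
Proof.
move=> sqf e_mod4; split=> [[Kz Az]|[a [b ->]]]; last first.
  split.
    apply: (subfieldD subK); first exact: subfield_int.
    by apply: (subfieldM subK); [exact: subfield_int | exact: Qadj_gen].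
  rewrite /= rpredD ?rpredM ?Aint_int // (Aint_expr (isT : (0 < 2)%N)) //.
  by rewrite w2 rpredN Aint_Cnat // natr_nat.
have [a [b [Qa Qb zE]]] := Qadj_quadratic Kz.
have zC : z^* = a - b * w.
  by rewrite zE rmorphD rmorphM /= (conj_quad_gen w2 e_gt0) !conj_Crat //; ring.
have AzC : z^* \in Aint by rewrite (Aint_aut Num.conj).
have /intrP[A AE] : 2 * a \in Num.int.
  apply: Cint_rat_Aint; first by rewrite rpredM ?rpred_nat.
  have -> : 2 * a = z + z^* by rewrite zC zE; ring.
  exact: rpredD.
have /intrP[M ME] : a ^+ 2 + e%:R * b ^+ 2 \in Num.int.
  apply: Cint_rat_Aint; first by rewrite rpredD ?rpredM ?rpredX ?rpred_nat.
  have -> : a ^+ 2 + e%:R * b ^+ 2 = z * z^*.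
    rewrite zC zE; transitivity (a ^+ 2 - b ^+ 2 * w ^+ 2); last by ring.
    by rewrite w2; ring.
  exact: rpredM.
have eb : e%:R * (2 * b) ^+ 2 = (4 * M - A ^+ 2)%:~R.
  have -> : e%:R * (2 * b) ^+ 2 = 4 * (a ^+ 2 + e%:R * b ^+ 2) - (2 * a) ^+ 2 by ring.
  by rewrite ME AE; ring.
have /intrP[B BE] : 2 * b \in Num.int.
  apply: (Crat_sqrt_int sqf); first by rewrite rpredM ?rpred_nat.
  by rewrite eb intr_int.
have eqM : e%:Z * B ^+ 2 = 4 * M - A ^+ 2.
  by apply: (@intr_inj algC); rewrite -eb BE; ring.
have [A' [B' [AE' BE']]] : exists A' B' : int, A = 2 * A' /\ B = 2 * B'.
  have mod2 (c : int) : exists c' r : int, c = 2 * c' + r /\ (r = 0 \/ r = 1).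
    by exists (c %/ 2)%Z, (c %% 2)%Z; have := divz_eq c 2; lia.
  have [A' [r [AE' r01]]] := mod2 A; have [B' [r' [BE' r'01]]] := mod2 B.
  exists A', B'; have eE : e%:Z = 4 * (e %/ 4)%N%:Z + 1 by lia.
  have sum4 : r ^+ 2 + r' ^+ 2 = 4 * (M - A' ^+ 2 - A' * r
      - (e %/ 4)%N%:Z * B ^+ 2 - B' ^+ 2 - B' * r').
    have -> : r' ^+ 2 = e%:Z * B ^+ 2 - 4 * (e %/ 4)%N%:Z * B ^+ 2
        - 4 * B' ^+ 2 - 4 * B' * r' by rewrite eE BE'; ring.
    by rewrite eqM AE'; ring.
  by move: sum4; move: (_ - _ : int) => S; case: r01 r'01 AE' BE' => -> [] ->; lia.
exists A', B'; rewrite zE.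
have two0 : 2 != 0 :> algC by rewrite pnatr_eq0.
by congr (_ + _ * _); apply: (mulfI two0); rewrite ?AE ?BE ?AE' ?BE'; ring.
Qed.

End QuadraticField.

Lemma Qadj_imaginary_unit (w : algC) (t : nat) : (0 < t)%N -> w ^+ 2 = - 1 ->
  Qadj (t%:R * w) = Qadj 'i.
Proof.
move=> t_gt0 w2.
have subw := is_subfield_Qadj (t%:R * w); have subi := is_subfield_Qadj 'i.
have Kw : Qadj (t%:R * w) w by apply: (@Qadj_gen w t).
have : w ^+ 2 == 'i ^+ 2 by rewrite w2 sqrCi.
rewrite eqf_sqr => /orP w_i.
apply/seteqP; split; apply: Qadj_sub => //.
  apply: (subfieldM subi); first exact: subfield_nat.
  case: w_i => /eqP->; first exact: Qadj_id.
  by apply: (subfieldN subi); apply: Qadj_id.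
case: w_i => /eqP wE; first by rewrite -wE.
have -> : 'i = - w by rewrite wE opprK.
by apply: (subfieldN subw).
Qed.

(** * The power equation for [delta] *)

Lemma odd_pow_eq_pow2_mul (w delta : algC) (e t m h : nat) :
  w ^+ 2 = - e%:R -> (e %% 4 = 1)%N -> odd m -> (1 < m)%N ->
  (t ^ 2 * e = 2 * m ^ (2 * h).+1 - 1)%N -> quad_int w delta ->
  delta ^+ (2 * h).+1 = 2 ^+ h * (1 + t%:R * w) -> h = 0%N.
Proof.
move=> w2 e_mod4 m_odd m_gt1 te_eq [U [V deltaE]] pow_eq.
have e_gt0 : (0 < e)%N by case: (e) e_mod4.
set p := (2 * h).+1 in te_eq pow_eq.
have mp_gt0 : (0 < m ^ p)%N by rewrite expn_gt0 (ltnW m_gt1).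
(* The [p]-th powers of both sides agree: the right side of [pow_eq] has norm
   [2 ^ (2 * h) * (1 + t ^ 2 * e)], which is [(2 * m) ^ p]. *)
have norm_delta : U ^+ 2 + e%:Z * V ^+ 2 = 2 * m%:Z.
  apply: (@intr_inj algC); rewrite -(normC_quad_int w2 e_gt0) -deltaE.
  have -> : (2 * m%:Z)%:~R = (2 * m)%:R :> algC by rewrite -PoszM.
  apply/eqP; rewrite -(@eqrXn2 _ p) ?exprn_ge0 ?normr_ge0 ?ler0n //.
  rewrite exprAC -normrX pow_eq normrM exprMn -[X in 1 + X]/(t%:Z%:~R * w).
  rewrite -[1]/(1%:~R) (normC_quad_int w2 e_gt0) normrX normr_nat -exprM.
  rewrite [(h * 2)%N]mulnC.
  apply/eqP.
  have -> : (1 ^+ 2 + e%:Z * t%:Z ^+ 2) = (2 * m ^ p)%N%:Z.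
    by rewrite -[t%:Z ^+ 2]/((t ^ 2)%N%:Z) -PoszM mulnC te_eq; lia.
  by rewrite -natrX -natrX expnMn [(2 ^ p)%N]expnSr -mulnA natrM.
(* Otherwise [2 * m] would be a square modulo 4, but [m] is odd. *)
have U_odd : odd (absz U).
  have eE : e%:Z = 4 * (e %/ 4)%N%:Z + 1 by lia.
  apply/negPn/negP => U_even.
  have [U' UE] : exists U', U = 2 * U' by exists (U %/ 2)%Z; lia.
  have [V' [r [VE r01]]] : exists V' r : int, V = 2 * V' + r /\ (r = 0 \/ r = 1).
    by exists (V %/ 2)%Z, (V %% 2)%Z; have := divz_eq V 2; lia.
  have [S] : exists S, 2 * m%:Z = 4 * S + r ^+ 2.
    exists (U' ^+ 2 + (e %/ 4)%N%:Z * V ^+ 2 + V' ^+ 2 + V' * r).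
    by rewrite -norm_delta eE UE VE; ring.
  by clear -r01 m_odd; case: r01 => ->; lia.
have conjE : delta^* = U%:~R - V%:~R * w.
  by rewrite deltaE rmorphD rmorphM /= (conj_quad_gen w2 e_gt0) !rmorph_int; ring.
have U0 : U%:~R != 0 :> algC by rewrite intr_eq0; lia.
have two0 : 2 != 0 :> algC by rewrite pnatr_eq0.
(* As [p] is odd, the trace [2 * U] of [delta] divides that of [delta ^+ p], which is
   [2 * 2 ^ h]. *)
have U_dvd : exists S : int, U * S = (2 ^ h)%N%:Z.
  have Aw : w \in Aint.
    by rewrite (Aint_expr (isT : (0 < 2)%N)) // w2 rpredN Aint_Cnat // natr_nat.
  have Adelta : delta \in Aint by rewrite deltaE rpredD ?rpredM ?Aint_int.
  have Aconj : - delta^* \in Aint by rewrite rpredN (Aint_aut Num.conj).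
  have := subrXX delta (- delta^* ) p; set Sum := \sum_(i < _) _ => pow_sum.
  have ASum : Sum \in Aint by apply: rpred_sum => i _; rewrite rpredM ?rpredX.
  have USum : U%:~R * Sum = 2 ^+ h.
    apply: (mulfI two0); transitivity ((delta - - delta^* ) * Sum).
      by rewrite conjE deltaE; ring.
    have conj_pow : (- delta^* ) ^+ p = - (delta ^+ p)^*.
      by rewrite exprNn -signr_odd /p oddS oddM /= mulN1r rmorphXn.
    rewrite -pow_sum conj_pow pow_eq rmorphM rmorphXn /= conjC_nat.
    by rewrite rmorphD rmorphM /= (conj_quad_gen w2 e_gt0) conjC_nat rmorph1; ring.
  have /intrP[S SE] : Sum \in Num.int.
    apply: Cint_rat_Aint => //; rewrite -(mulKf U0 Sum) USum.
    by rewrite rpredM ?rpredV ?rpredX ?rpred_nat ?rpred_int.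
  exists S; apply: (@intr_inj algC); rewrite rmorphM /= -SE USum.
  by rewrite -natrX.
have U1 : U = 1 \/ U = - 1.
  have [S US] := U_dvd.
  have /dvdn_pfactor : (absz U %| 2 ^ h)%N.
    by rewrite -[(2 ^ h)%N]/(absz (2 ^ h)%N%:Z) -US abszM dvdn_mulr.
  move=> /(_ isT)[[|k] _ UE]; first by lia.
  by move: U_odd; rewrite UE expnS oddM.
have U2 : U * U = 1 by case: U1 => ->.
pose w' := (U * V)%:~R * w.
have eV : (e%:Z * V ^+ 2) = (2 * m - 1)%N%:Z by nia.
have w'2 : w' ^+ 2 = - (2 * m - 1)%:R.
  transitivity ((U * U)%:~R * V%:~R ^+ 2 * w ^+ 2); first by rewrite /w'; ring.
  rewrite U2 w2 -[(2 * m - 1)%:R]/((2 * m - 1)%N%:Z%:~R) -eV; ring.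
have delta'E : U%:~R * delta = 1 + w'.
  rewrite deltaE /w'; transitivity ((U * U)%:~R + (U * V)%:~R * w); first by ring.
  by rewrite U2.
have gammaE : delta ^+ 2 = 2 * (1 - m%:R + w').
  transitivity ((U * U)%:~R * delta ^+ 2); first by rewrite U2 mul1r.
  transitivity ((U%:~R * delta) ^+ 2); first by ring.
  rewrite delta'E; transitivity (1 + 2 * w' + w' ^+ 2); first by ring.
  by rewrite w'2 natrB; [ring | lia].
have [s [b sE]] : quad_int w' ((1 + w') * (1 - m%:R + w') ^+ h).
  by quad_int_closure w'2.
apply: (rational_part_pm1 m_odd m_gt1 w'2 sE).
(* Dividing [delta ^+ p] by [2 ^ h] shows that the product is [U * (1 + t * w)]. *)
suff [-> _] : s = U /\ b * (U * V) = U * t%:Z by [].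
apply: (quad_int_inj w2 e_gt0).
transitivity (s%:~R + b%:~R * w'); first by rewrite /w'; ring.
rewrite -sE; apply: (mulfI (expf_neq0 h two0)).
transitivity (U%:~R * (delta * (delta ^+ 2) ^+ h)).
  by rewrite gammaE [RHS]mulrA delta'E exprMn; ring.
by rewrite -exprM -exprS pow_eq; ring.
Qed.

(** * Comaximal conjugates and divisibility of the class number *)

(** At each step [y * b ^+ n] is multiplied by [u * b + v * b'], and the part with [b'] joins
    [x]. *)
Lemma bezout_pow (w b b' u v : algC) (e n : nat) : w ^+ 2 = - e%:R ->
  quad_int w b -> quad_int w b' -> quad_int w u -> quad_int w v ->
  1 = u * b + v * b' ->
  exists x y, [/\ quad_int w x, quad_int w y & 1 = x * b' + y * b ^+ n].
Proof.
move=> w2 qb qb' qu qv bez; elim: n => [|n [x [y [qx qy bez_n]]]].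
  exists 0, 1; split; [exact: quad_int_nat 0 | exact: quad_int_nat 1 | ring].
exists (x + y * b ^+ n * v), (y * u).
split; [by quad_int_closure w2 | by quad_int_closure w2 |].
rewrite [LHS]bez_n -[y * b ^+ n]mulr1 {1}bez exprS; ring.
Qed.

Theorem theorem2 (p q r m : nat) (d : algC)
  (p_prime : prime p) (p_ge3 : (3 <= p)%N)
  (q_prime : prime q) (q_ge3 : (3 <= q)%N)
  (r_gt0 : (0 < r)%N)
  (m_def : m = (q ^ r)%N)
  (d_def : d = 1 - 2 * m%:R ^+ p)
  (not_Qi : Qadj (sqrtC d) <> Qadj 'i) :
  finite_set (ideal_classes (Qadj (sqrtC d))) /\
  (p %| class_number (Qadj (sqrtC d)))%N.
Proof.
have p_odd : odd p by case: (even_prime p_prime) p_ge3 => [->|].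
have q_odd : odd q by case: (even_prime q_prime) q_ge3 => [->|].
have m_odd : odd m by rewrite m_def oddX q_odd orbT.
have m_gt1 : (1 < m)%N by rewrite m_def -(exp1n r) ltn_exp2r // prime_gt1.
have mp_odd : odd (m ^ p) by rewrite oddX m_odd orbT.
have mp_gt0 : (0 < m ^ p)%N by rewrite expn_gt0 (ltnW m_gt1).
have [t [e [te_eq sqf]]] : exists t e, (2 * m ^ p - 1 = t ^ 2 * e)%N /\
    forall k, (k ^ 2 %| e)%N -> k = 1%N.
  by apply: square_factorization; lia.
(* [m ^ p] is odd, so [t ^ 2 * e] is 1 modulo 4; hence [t] is odd and its square is 1 modulo 4. *)
have e_mod4 : (e %% 4 = 1)%N.
  have : ((t ^ 2 * e) %% 4 = 1)%N by rewrite -te_eq; lia.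
  rewrite -modnMml -modnXm; have := ltn_pmod t (isT : (0 < 4)%N).
  by case: (t %% 4)%N => [|[|[|[|]]]] //=; rewrite ?mul0n ?mod0n ?mul1n.
have e_gt0 : (0 < e)%N by case: (e) e_mod4.
have t_gt0 : (0 < t)%N by case: (t) te_eq => //; rewrite mul0n; lia.
pose w : algC := sqrtC (- e%:R); have w2 : w ^+ 2 = - e%:R by rewrite sqrtCK.
have sqrt_d : sqrtC d = t%:R * w.
  have -> : d = t%:R ^+ 2 * - e%:R.
    rewrite d_def; transitivity (- (t ^ 2 * e)%:R : algC); last by ring.
    by rewrite -te_eq natrB; [rewrite natrM natrX; ring | lia].
  by rewrite rootCMl ?exprn_ge0 // sqrCK.
move: not_Qi; rewrite sqrt_d; set K := Qadj _ => not_Qi.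
have e_gt1 : (1 < e)%N.
  rewrite ltn_neqAle e_gt0 andbT; apply/negP => /eqP e1; apply: not_Qi.
  by apply: Qadj_imaginary_unit; rewrite // w2 -e1.
have OK z : ring_of_integers K z <-> quad_int w z.
  exact: (ring_of_integers_Qadj w2 e_gt0 t_gt0 z sqf e_mod4).
have fin_cl := ideal_classes_finite w2 e_gt0 OK.
split=> //; pose subK : is_subfield K := is_subfield_Qadj _.
have Kw : K w by apply: Qadj_gen.
have tw2 : (t%:R * w) ^+ 2 = 1 - 2 * m%:R ^+ p.
  by rewrite -sqrt_d sqrtCK d_def.
pose b := 1 - m%:R ^+ p + t%:R * w; pose b' := 1 - m%:R ^+ p - t%:R * w.
have qw := quad_int_gen w.
have qb : quad_int w b by rewrite /b; quad_int_closure w2.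
have qb' : quad_int w b' by rewrite /b'; quad_int_closure w2.
have bb' : (m%:R ^+ 2) ^+ p = b * b'.
  transitivity ((1 - m%:R ^+ p) ^+ 2 - (t%:R * w) ^+ 2); last by rewrite /b /b'; ring.
  by rewrite tw2 exprAC; ring.
have m0 : m%:R != 0 :> algC by rewrite pnatr_eq0; lia.
have b0 : b != 0.
  have : b * b' != 0 by rewrite -bb' !expf_neq0.
  by apply: contraNneq => ->; rewrite mul0r.
pose k := (m ^ p)./2.
(* With [m ^ p = 2 * k + 1], [b + b' = - 4 * k] and [b * b' = (2 * k + 1) ^ 2], so
   [(k + 1) * (b + b') + b * b' = 1]. *)
have bez : 1 = k.+1%:R * b + (b + k.+1%:R) * b'.
  have mpE : m%:R ^+ p = 2 * k%:R + 1 :> algC.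
    by rewrite -natrX; have {1}-> : (m ^ p = 2 * k + 1)%N by [rewrite /k; lia]; ring.
  have -> : k.+1%:R * b + (b + k.+1%:R) * b' = k.+1%:R * (b + b') + b * b' by ring.
  by rewrite -bb' exprAC /b /b' mpE; ring.
have [u [v [qu qv bez_p]]] := bezout_pow p.-1 w2 qb qb' (quad_int_nat w _)
  (quad_intD qb (quad_int_nat w _)) bez.
apply: (dvdn_class_number w2 e_gt0 OK subK e_gt1 fin_cl p_prime p_odd
  _ _ _ _ _ b0 bb' bez_p); try by apply/OK.
  by apply/OK; quad_int_closure w2.
move=> x y [Kx _] [Ky _] x0 y0 pow_eq.
pose h := p./2; have pE : p = (2 * h).+1 by rewrite /h; lia.
suff : h = 0%N by rewrite /h; lia.
have tw_K : K (1 + t%:R * w).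
  apply: (subfieldD subK); first exact: subfield1.
  by apply: (subfieldM subK) => //; apply: subfield_nat.
(* Since [gamma ^+ p = b] and [2 * b] is the square of [1 + t * w], the exponent [h] gives
   [delta ^+ 2 = 2 * gamma], so [delta] is integral. *)
pose gamma := y / x; pose delta := (1 + t%:R * w) / gamma ^+ h.
have gamma_b : gamma ^+ p = b.
  by rewrite expr_div_n -pow_eq mulfK // expf_neq0.
have gamma0 : gamma != 0 by rewrite mulf_neq0 ?invr_neq0.
have gammaK : K gamma by apply: (subfield_div subK).
have deltaK : K delta by apply: (subfield_div subK) => //; apply: (subfieldX subK).
have alpha2 : (1 + t%:R * w) ^+ 2 = 2 * b.
  transitivity (1 + 2 * (t%:R * w) + (t%:R * w) ^+ 2); first by ring.
  by rewrite tw2 /b; ring.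
have gammaA : gamma \in Aint.
  apply: (Aint_expr (prime_gt0 p_prime)); rewrite gamma_b.
  by have /OK[] := qb.
have delta2 : delta ^+ 2 = 2 * gamma.
  rewrite expr_div_n alpha2 -gamma_b -exprM pE exprS [(h * 2)%N]mulnC.
  by rewrite mulrA mulfK // expf_neq0.
have deltaO : quad_int w delta.
  apply/OK; split=> //=; apply: (Aint_expr (isT : (0 < 2)%N)).
  by rewrite delta2 rpredM // Aint_Cnat // natr_nat.
apply: (odd_pow_eq_pow2_mul w2 e_mod4 m_odd m_gt1 _ deltaO (t := t)).
  by rewrite -pE te_eq.
rewrite exprS exprM delta2 exprMn mulrCA /delta divfK // expf_neq0 //.
Qed.
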